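(* Let $n,m\geq 2$ and let $\Phi$ be an endomorphism of $F_n\times F_m$. Then $\Phi$ is coarse-median preserving (with respect to the product coarse median on $F_n\times F_m$) if and only if $\Phi$ is uniformly continuous with respect to the product metric obtained by taking the prefix metric in each factor.
   Context: $F_n$ denotes the free group of rank $n$ with a fixed basis; maps are written on the right of their arguments. Prefix metric: for reduced words $u,v$ in a free group, let $u\wedge v$ be their longest common prefix; the prefix metric is $2^{-|u\wedge v|}$ if $u\neq v$ and $0$ if $u=v$. The product metric on $F_n\times F_m$ is the maximum of the prefix metrics in the two coordinates (an ultrametric). Coarse median: a free group $F$, being hyperbolic, carries the coarse median $\mu_F:F^3\to F$ sending three points to a center of a geodesic triangle which they span in the Cayley graph; with respect to the fixed basis the Cayley graph is a tree and $\mu_F(x,y,z)$ is the unique vertex lying on the three geodesics $[x,y]$, $[y,z]$, $[x,z]$. With $\mu_1=\mu_{F_n}$ and $\mu_2=\mu_{F_m}$, the product coarse median on $F_n\times F_m$ is $$\mu\bigl((x_1,x_2),(y_1,y_2),(z_1,z_2)\bigr)=\bigl(\mu_1(x_1,y_1,z_1),\mu_2(x_2,y_2,z_2)\bigr).$$ An endomorphism $\Phi$ of $F_n\times F_m$ is coarse-median preserving if there is a constant $C\geq 0$ such that, for all $g_1,g_2,g_3\in F_n\times F_m$, $$d\bigl(\mu(g_1,g_2,g_3)\Phi,\ \mu(g_1\Phi,g_2\Phi,g_3\Phi)\bigr)\leq C,$$ where $d$ is some word metric on $F_n\times F_m$ (with respect to a finite generating set). *)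

(* Defs.v *)
From HB Require Import structures.
From mathcomp Require Import all_boot all_order all_algebra.
From mathcomp Require Import all_classical all_reals topology.

Set Implicit Arguments.
Unset Strict Implicit.
Unset Printing Implicit Defensive.

Import Order.TTheory GRing.Theory Num.Theory.

(* The letter (i, true) is the i-th basis element, (i, false) its inverse. *)
Definition letter (n : nat) : Type := ('I_n * bool)%type.
HB.instance Definition _ n := Finite.on (letter n).

Definition linv n (a : letter n) : letter n := (a.1, ~~ a.2).

Lemma linvK n : involutive (@linv n).
Proof. by case=> i b; rewrite /linv /= negbK. Qed.

Definition reduced n (w : seq (letter n)) : bool :=
  sorted (fun a b => b != linv a) w.

Record free_group (n : nat) :=
  FreeGroup { fword : seq (letter n); fword_reduced : reduced fword }.

HB.instance Definition _ n := [isSub for @fword n].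
HB.instance Definition _ n := [Choice of free_group n by <:].

Section FreeGroupLaw.
Variable n : nat.
Implicit Types (a b : letter n) (u v w : seq (letter n)).

Definition push a w : seq (letter n) :=
  if w is b :: w' then if b == linv a then w' else a :: w else [:: a].

Definition rmul u v : seq (letter n) := foldr push v u.

Definition rinv u : seq (letter n) := rev (map (@linv n) u).

Lemma reduced_behead a w : reduced (a :: w) -> reduced w.
Proof. exact: path_sorted. Qed.

Lemma reduced_push a w : reduced w -> reduced (push a w).
Proof.
case: w => // b w rw /=; case: ifPn => [_|ba]; first exact: reduced_behead rw.
by rewrite /reduced /= ba.
Qed.

Lemma reduced_rmul u v : reduced v -> reduced (rmul u v).
Proof. by move=> rv; elim: u => //= a u; exact: reduced_push. Qed.

Lemma reduced_rinv u : reduced u -> reduced (rinv u).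
Proof.
rewrite /reduced /rinv rev_sorted sorted_map; apply: sub_sorted => a b /= ba.
by rewrite linvK eq_sym.
Qed.

Lemma pushK a w : reduced w -> push (linv a) (push a w) = w.
Proof.
case: w => [|b w] /=; first by rewrite linvK eqxx.
case: (eqVneq b (linv a)) => [->|_ _] /=; last by rewrite linvK eqxx.
by case: w => //= c w /andP[+ _]; rewrite linvK => /negPf ->.
Qed.

Lemma pushVK a w : reduced w -> push a (push (linv a) w) = w.
Proof. by move=> rw; rewrite -{1}[a]linvK pushK. Qed.

Lemma rmul_push a v w : reduced w -> rmul (push a v) w = push a (rmul v w).
Proof.
move=> rw; case: v => //= b v; case: eqP => //= ->.
by rewrite pushVK // reduced_rmul.
Qed.

Lemma rmulA u v w : reduced w -> rmul u (rmul v w) = rmul (rmul u v) w.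
Proof.
by move=> rw; elim: u => //= a u ->; rewrite rmul_push.
Qed.

Lemma rmul_cat u v : reduced (u ++ v) -> rmul u v = u ++ v.
Proof.
elim: u => //= a u IH r; rewrite IH; last exact: reduced_behead r.
by case: (u ++ v) r => //= b w /andP[/negPf -> _].
Qed.

Lemma rmulw1 u : reduced u -> rmul u [::] = u.
Proof. by move=> ru; rewrite rmul_cat cats0. Qed.

Lemma rinvK : involutive rinv.
Proof.
by move=> u; rewrite /rinv map_rev revK -map_comp map_id_in // => a _; exact: linvK.
Qed.

Lemma rmul_catK u v : reduced v -> rmul (rinv u) (rmul u v) = v.
Proof.
elim: u v => //= a u IH v rv.
rewrite /rinv /= rev_cons -/(rinv u) /rmul foldr_rcons.
by rewrite pushK; [exact: IH | exact: reduced_rmul].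
Qed.

Lemma rmulVw u : reduced u -> rmul (rinv u) u = [::].
Proof. by move=> ru; rewrite -{2}(rmulw1 ru) rmul_catK. Qed.

Definition fmul (x y : free_group n) : free_group n :=
  FreeGroup (reduced_rmul (fword x) (fword_reduced y)).
Definition fone : free_group n := @FreeGroup n [::] isT.
Definition finv (x : free_group n) : free_group n :=
  FreeGroup (reduced_rinv (fword_reduced x)).

Lemma fmulA : associative fmul.
Proof. by move=> x y z; apply: val_inj; rewrite /= rmulA // fword_reduced. Qed.
Lemma fmul1g : left_id fone fmul.
Proof. by move=> x; apply: val_inj. Qed.
Lemma fmulg1 : right_id fone fmul.
Proof. by move=> x; apply: val_inj; rewrite /= rmulw1 // fword_reduced. Qed.
Lemma fmulVg : left_inverse fone finv fmul.
Proof. by move=> x; apply: val_inj; rewrite /= rmulVw // fword_reduced. Qed.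
Lemma fmulgV : right_inverse fone finv fmul.
Proof.
move=> x; apply: val_inj => /=.
by rewrite -{1}[fword x]rinvK rmulVw // reduced_rinv // fword_reduced.
Qed.

HB.instance Definition _ := isGroup.Build (free_group n)
  fmulA fmul1g fmulg1 fmulVg fmulgV.

End FreeGroupLaw.

(* The finite set of generators is given by a sequence. *)
Section WordMetric.
Local Open Scope group_scope.
Variables (G : groupType) (S : seq G).

Definition word_of_length (k : nat) (g : G) : Prop :=
  exists w : seq G, [/\ size w = k,
    forall s, s \in w -> s \in S \/ s^-1 \in S & g = \prod_(s <- w) s].

Definition generates : Prop := forall g, exists k, word_of_length k g.

Hypothesis genS : generates.

Lemma ex_word_length g : exists k, `[< word_of_length k g >].
Proof. by have [k gk] := genS g; exists k; apply/asboolP. Qed.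

Definition word_length (g : G) : nat := ex_minn (ex_word_length g).

Definition word_dist (g h : G) : nat := word_length (g^-1 * h).

End WordMetric.

Section CayleyTree.
Local Open Scope group_scope.
Variable n : nat.
Implicit Types x y z v : free_group n.

Definition fletter (a : letter n) : free_group n := @FreeGroup n [:: a] isT.

Definition free_basis : seq (free_group n) :=
  [seq fletter (i, true) | i <- enum 'I_n].

Lemma fletterV a : (fletter a)^-1 = fletter (linv a).
Proof. exact: val_inj. Qed.

Lemma free_basisP x :
  reflect (exists i, x = fletter (i, true)) (x \in free_basis).
Proof.
apply: (iffP mapP) => [[i _ ->]|[i ->]]; first by exists i.
by exists i => //; rewrite mem_enum.
Qed.

Lemma fletter_basis a : fletter a \in free_basis \/ (fletter a)^-1 \in free_basis.
Proof.
by case: a => i []; [left|right; rewrite fletterV]; apply/free_basisP; exists i.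
Qed.

Lemma basis_fletter x :
  x \in free_basis \/ x^-1 \in free_basis -> exists a, x = fletter a.
Proof.
case=> /free_basisP[i xE]; first by exists (i, true).
by exists (i, false); rewrite -[x]invgK xE fletterV.
Qed.

Lemma fword_prod (s : seq (letter n)) :
  fword (\prod_(a <- s) fletter a) = rmul s [::].
Proof. by elim: s => [|a s IH]; rewrite ?big_nil // big_cons /= IH. Qed.

Lemma fword_length x : word_of_length free_basis (size (fword x)) x.
Proof.
exists (map fletter (fword x)); split; first by rewrite size_map.
  by move=> _ /mapP[a _ ->]; exact: fletter_basis.
apply: val_inj; rewrite big_map /= fword_prod rmulw1 //; exact: fword_reduced.
Qed.

Lemma free_basis_generates : generates free_basis.
Proof. by move=> x; exists (size (fword x)); exact: fword_length. Qed.

Definition cayley_dist : free_group n -> free_group n -> nat :=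
  word_dist free_basis_generates.

(* The vertices of the geodesic [x, y] are those at which the triangle
   inequality d(x, y) <= d(x, v) + d(v, y) is an equality. *)
Definition on_geodesic x y v : bool :=
  cayley_dist x v + cayley_dist v y == cayley_dist x y.

Definition is_center x y z v : bool :=
  [&& on_geodesic x y v, on_geodesic y z v & on_geodesic x z v].

Lemma size_push a (w : seq (letter n)) : size (push a w) <= (size w).+1.
Proof. by case: w => //= b w; case: ifP => //= _; rewrite -addn2 leq_addr. Qed.

Lemma size_rmul (u v : seq (letter n)) : size (rmul u v) <= size u + size v.
Proof.
by elim: u => //= a u IH; rewrite addSn (leq_trans (size_push _ _)).
Qed.

Lemma word_lengthE x : word_length free_basis_generates x = size (fword x).
Proof.
rewrite /word_length; case: ex_minnP => k /asboolP[w [<- wS ->]] kmin.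
apply/eqP; rewrite eqn_leq; apply/andP; split.
  apply: kmin; apply/asboolP; exact: fword_length.
elim: w wS {kmin} => [|s w IH] wS; first by rewrite big_nil.
rewrite big_cons /=; have [a ->] : exists a, s = fletter a.
  by apply: basis_fletter; apply: wS; rewrite mem_head.
apply: leq_trans (size_push _ _) _; rewrite ltnS; apply: IH => t tw.
by apply: wS; rewrite in_cons tw orbT.
Qed.

Lemma cayley_distE x y : cayley_dist x y = size (fword (x^-1 * y)).
Proof. exact: word_lengthE. Qed.

Lemma cayley_distC x y : cayley_dist x y = cayley_dist y x.
Proof.
rewrite !cayley_distE -[y^-1 * x]invgK invgM invgK /=.
by rewrite /rinv size_rev size_map.
Qed.

Lemma cayley_distM x y z : cayley_dist (x * y) (x * z) = cayley_dist y z.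
Proof. by rewrite !cayley_distE invgM -mulgA mulKg. Qed.

End CayleyTree.

Section CommonPrefix.
Variable T : eqType.
Implicit Types s t r : seq T.

Fixpoint lcp s t : seq T :=
  match s, t with
  | a :: s', b :: t' => if a == b then a :: lcp s' t' else [::]
  | _, _ => [::]
  end.

Lemma prefix_lcp r s t : prefix r (lcp s t) = prefix r s && prefix r t.
Proof.
elim: s t r => [|a s IH] [|b t] [|c r] //=; rewrite ?andbF ?prefix0s //.
case: eqP => [<-|ab] /=; first by rewrite IH; case: (c == a).
case: (eqVneq c a) => //= ca.
case: (eqVneq c b) => cb; last by rewrite andbF.
by case: ab; rewrite -ca -cb.
Qed.

Lemma lcpC s t : lcp s t = lcp t s.
Proof.
elim: s t => [|a s IH] [|b t] //=.
by rewrite eq_sym; case: eqP => // ->; rewrite IH.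
Qed.

Lemma lcpP s t : exists s' t', [/\ s = lcp s t ++ s', t = lcp s t ++ t' &
  forall a b s1 t1, s' = a :: s1 -> t' = b :: t1 -> a != b].
Proof.
elim: s t => [|a s IH] [|b t] /=.
- by exists [::], [::].
- by exists [::], (b :: t).
- by exists (a :: s), [::].
case: eqP => [<-|/eqP ab]; last first.
  by exists (a :: s), (b :: t); split=> // ? ? ? ? [<- _] [<- _].
have [s' [t' [sE tE h]]] := IH t.
by exists s', t'; split=> //; rewrite [in LHS](sE, tE).
Qed.

Lemma lcp_ultra r s t :
  minn (size (lcp s r)) (size (lcp r t)) <= size (lcp s t).
Proof.
elim: s r t => [|a s IH] [|b r] [|c t] //=; rewrite ?minn0 ?min0n //.
case: (eqVneq a b) => [<-|_] /=; last by rewrite min0n.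
by case: eqP => //= _; rewrite ?minn0 // minnSS ltnS.
Qed.

End CommonPrefix.

Section Median.
Local Open Scope group_scope.
Variable n : nat.
Implicit Types x y z v : free_group n.

Lemma reduced_catr (u v : seq (letter n)) : reduced (u ++ v) -> reduced v.
Proof. by elim: u => //= a u IH /reduced_behead. Qed.

Lemma reduced_catl (u v : seq (letter n)) : reduced (u ++ v) -> reduced u.
Proof. by rewrite /reduced; case: u => //= a u; rewrite cat_path => /andP[]. Qed.

Lemma rmul_prefix (u v : seq (letter n)) :
  size (rmul u v) = size u + size v -> rmul u v = u ++ v.
Proof.
elim: u => //= a u IH; rewrite addSn => h.
have le1 := size_push a (rmul u v); rewrite h ltnS in le1.
have e : size (rmul u v) = size u + size v.
  by apply/eqP; rewrite eqn_leq size_rmul.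
rewrite -IH // ; case: (rmul u v) e h => //= b w <-.
by case: ifP => //= _ /eqP; rewrite -addn2 -{1}[size w]addn0 eqn_add2l.
Qed.

Lemma rinv_catK (u v : seq (letter n)) :
  reduced (u ++ v) -> rmul (rinv u) (u ++ v) = v.
Proof.
by move=> r; rewrite -(rmul_cat r) rmul_catK //; exact: reduced_catr r.
Qed.

Lemma on_geodesic1 y v : on_geodesic 1 y v = prefix (fword v) (fword y).
Proof.
rewrite /on_geodesic !cayley_distE !invg1 !mul1g.
apply/eqP/idP => [h|/prefixP[s yE]].
  have yE : fword y = rmul (fword v) (fword (v^-1 * y)).
    by rewrite -[in LHS](mulVKg v y).
  by rewrite yE rmul_prefix -?yE ?h // prefix_prefix.
have ry := fword_reduced y; rewrite yE in ry.
by rewrite /= yE rinv_catK // size_cat.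
Qed.

Lemma on_geodesicM t x y v :
  on_geodesic (t * x) (t * y) (t * v) = on_geodesic x y v.
Proof. by rewrite /on_geodesic !cayley_distM. Qed.

Lemma is_centerM t x y z v :
  is_center (t * x) (t * y) (t * z) (t * v) = is_center x y z v.
Proof. by rewrite /is_center !on_geodesicM. Qed.

Lemma center_uniq_ex x y z :
  exists v, forall w, is_center x y z w = (w == v).
Proof.
suff H : forall a b : free_group n, exists p, forall w, is_center 1 a b w = (w == p).
  have [p pP] := H (x^-1 * y) (x^-1 * z); exists (x * p) => w.
  have := is_centerM x 1 (x^-1 * y) (x^-1 * z) (x^-1 * w).
  rewrite mulg1 (mulVKg x y) (mulVKg x z) (mulVKg x w) pP => ->.
  by apply/eqP/eqP => [<-|->]; [rewrite (mulVKg x w) | rewrite (mulKg x p)].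
move=> a b.
have [s [t [aE bE st]]] := lcpP (fword a) (fword b).
set p := lcp _ _ in aE bE.
have ra := fword_reduced a; have rb := fword_reduced b.
rewrite aE in ra; rewrite bE in rb.
exists (FreeGroup (reduced_catl ra)) => w.
rewrite /is_center !on_geodesic1 andbCA -prefix_lcp -/p.
have rs := reduced_catr ra; have rt := reduced_catr rb.
have dab q s' t' : fword a = q ++ s' -> fword b = q ++ t' ->
    forall v, fword v = q ->
    cayley_dist a v = size s' /\ cayley_dist v b = size t'.
  move=> aE' bE' v vE.
  have ra' := fword_reduced a; have rb' := fword_reduced b.
  rewrite aE' in ra'; rewrite bE' in rb'.
  by rewrite cayley_distC !cayley_distE /= vE aE' bE' !rinv_catK.
have dE : cayley_dist a b = size s + size t.
  have -> : cayley_dist a b = size (rmul (rinv s) t).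
    rewrite -(cayley_distM (FreeGroup (reduced_catl ra))^-1) cayley_distE /=.
    rewrite aE bE !rinv_catK //.
  rewrite rmul_cat; first by rewrite size_cat /rinv size_rev size_map.
  have := reduced_rinv rs; rewrite /rinv /reduced.
  case: s st {aE ra rs dab} => //= c s st; rewrite rev_cons.
  case: t st rt {bE rb} => [|d t] st rt; first by rewrite cats0.
  rewrite cat_rcons; case: (rev _) => [|e r] /=.
    by rewrite linvK eq_sym (st _ _ _ _ erefl erefl).
  rewrite cat_path rcons_path /= => /andP[-> ->].
  by rewrite linvK eq_sym (st _ _ _ _ erefl erefl).
apply/andP/eqP => [[g /prefixP[q pq]]|->]; last first.
  split; last exact: prefix_refl.
  have [d1 d2] := dab _ _ _ aE bE (FreeGroup (reduced_catl ra)) erefl.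
  by rewrite /on_geodesic d1 d2 dE.
rewrite pq -!catA in aE bE.
have [d1 d2] := dab _ _ _ aE bE w erefl.
move: g; rewrite /on_geodesic d1 d2 dE !size_cat addnACA -{2}[(_ + size t)%N]add0n.
rewrite eqn_add2r addn_eq0 => /andP[/nilP q0 _]; apply: val_inj => /=.
by rewrite pq q0 cats0.
Qed.

Lemma ex_center x y z : exists v, is_center x y z v.
Proof. by have [v vP] := center_uniq_ex x y z; exists v; rewrite vP. Qed.

Definition median x y z : free_group n := xchoose (ex_center x y z).

Lemma medianP x y z v : is_center x y z v = (v == median x y z).
Proof.
have [c cP] := center_uniq_ex x y z.
by have := xchooseP (ex_center x y z); rewrite !cP -/(median x y z) => /eqP ->.
Qed.

End Median.

Definition prod_median n m (x y z : free_group n * free_group m) :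
    free_group n * free_group m :=
  (median x.1 y.1 z.1, median x.2 y.2 z.2).

Definition coarse_median_preserving n m
    (S : seq (free_group n * free_group m)) (genS : generates S)
    (Phi : free_group n * free_group m -> free_group n * free_group m) : Prop :=
  exists C : nat, forall g1 g2 g3,
    word_dist genS (Phi (prod_median g1 g2 g3))
                   (prod_median (Phi g1) (Phi g2) (Phi g3)) <= C.

(* A copy of the free group, carrying the R-valued prefix metric. *)
Definition prefix_space (R : realType) (n : nat) : Type := free_group n.
HB.instance Definition _ R n := Choice.copy (prefix_space R n) (free_group n).

Section PrefixMetric.
Local Open Scope ring_scope.
Variables (R : realType) (n : nat).
Implicit Types u v w : prefix_space R n.

Definition prefix_dist u v : R :=
  if u == v then 0 else 2^-1 ^+ size (lcp (fword u) (fword v)).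

Lemma prefix_distxx u : prefix_dist u u = 0.
Proof. by rewrite /prefix_dist eqxx. Qed.

Lemma prefix_dist_eq0 u v : prefix_dist u v = 0 -> u = v.
Proof.
rewrite /prefix_dist; case: eqP => // _ /eqP.
by rewrite expf_eq0 invr_eq0 pnatr_eq0 andbF.
Qed.

Lemma prefix_distC u v : prefix_dist u v = prefix_dist v u.
Proof. by rewrite /prefix_dist eq_sym lcpC. Qed.

Lemma prefix_dist_ge0 u v : 0 <= prefix_dist u v.
Proof. by rewrite /prefix_dist; case: ifP => // _; rewrite exprn_ge0 ?invr_ge0 ?ler0n. Qed.

Lemma prefix_dist_ultra v u w :
  prefix_dist u w <= Num.max (prefix_dist u v) (prefix_dist v w).
Proof.
have [->|uv] := eqVneq u v; first by rewrite le_max lexx orbT.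
have [->|vw] := eqVneq v w; first by rewrite le_max lexx.
have [->|uw] := eqVneq u w.
  by rewrite prefix_distxx le_max prefix_dist_ge0.
rewrite /prefix_dist (negPf uv) (negPf vw) (negPf uw) le_max.
have i2 : (2^-1 : R) <= 1 by rewrite invf_le1 ?ltr0n ?ler1n.
have := lcp_ultra (fword v) (fword u) (fword w); rewrite geq_min.
by case/orP=> h; apply/orP; [left|right]; apply: (ler_wiXn2l _ i2 h);
  rewrite invr_ge0 ler0n.
Qed.

Lemma prefix_dist_triangle v u w :
  prefix_dist u w <= prefix_dist u v + prefix_dist v w.
Proof.
apply: le_trans (prefix_dist_ultra v u w) _.
by rewrite ge_max lerDl lerDr !prefix_dist_ge0.
Qed.

HB.instance Definition _ := isMetric.Build R (prefix_space R n)
  prefix_distxx prefix_dist_eq0 prefix_distC prefix_dist_triangle.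

End PrefixMetric.

Section ProductMetric.
Local Open Scope ring_scope.
Local Open Scope classical_set_scope.
Variables (R : realType) (U V : metricType R).
Implicit Types x y : (U * V)%type.

Definition max_dist x y : R := Num.max (mdist x.1 y.1) (mdist x.2 y.2).

Lemma max_dist_ge0 x y : 0 <= max_dist x y.
Proof. by rewrite le_max mdist_ge0. Qed.

Lemma max_dist_eq0 x y : max_dist x y = 0 -> x = y.
Proof.
case: x y => [x1 x2] [y1 y2]; rewrite /max_dist /= => h.
have /andP[h1 h2] : (mdist x1 y1 <= 0) && (mdist x2 y2 <= 0).
  by rewrite -ge_max h.
by congr pair; apply: mdist_positivity; apply/eqP; rewrite eq_le mdist_ge0 andbT.
Qed.

Lemma ball_max_dist x (e : R) : ball x e = [set y | max_dist x y < e].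
Proof.
apply/seteqP; split=> y; rewrite /max_dist /= gt_max.
  by case; rewrite !ballEmdist /= => -> ->.
by case/andP=> h1 h2; split; rewrite !ballEmdist.
Qed.

(* The library has the product pseudometric, whose balls are products of balls;
   this adds the distance that defines them. *)
HB.instance Definition _ := PseudoMetric_isMetric.Build R (U * V)%type
  max_dist_ge0 max_dist_eq0 ball_max_dist.

End ProductMetric.

Definition prefix_unif_continuous (R : realType) n m
    (Phi : free_group n * free_group m -> free_group n * free_group m) : Prop :=
  unif_continuous
    (Phi : prefix_space R n * prefix_space R m ->
           prefix_space R n * prefix_space R m).

Lemma prefix_unif_continuousP (R : realType) n m
    (Phi : free_group n * free_group m -> free_group n * free_group m) :
  let d (x y : free_group n * free_group m) : R :=
    Num.max (prefix_dist (x.1 : prefix_space R n) y.1)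
            (prefix_dist (x.2 : prefix_space R m) y.2) in
  prefix_unif_continuous R Phi <->
  (forall e : R, (0 < e)%R -> exists2 delta : R, (0 < delta)%R &
    forall x y, (d x y < delta)%R -> (d (Phi x) (Phi y) < e)%R).
Proof.
move=> d; pose P := (prefix_space R n * prefix_space R m)%type.
have bE (x y : P) (e : R) : ball x e y <-> (d x y < e)%R.
  by rewrite ballEmdist.
split.
  move/unif_continuousP => h e e0; have [/= r r0 hr] := h e e0.
  by exists r => // x y /bE xy; apply/bE; exact: (hr (x, y)).
move=> h; apply/unif_continuousP => e e0; have [r r0 hr] := h e e0.
by exists r => // -[x y] /= /bE xy; apply/bE; exact: hr.
Qed.

(* Main.v *)
Require Import Defs.
From mathcomp Require Import all_boot all_order all_algebra.
From mathcomp Require Import all_classical all_reals topology.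
From mathcomp Require Import zify.

(* Composing Phi with the projections reduces the theorem to homomorphisms f from
   F_n x F_m to a free group.  For these, both conditions are equivalent to
   [thin_kernel f]: if the kernel contains some (w1, w2) with both entries
   nontrivial, then f is trivial.
   - Uniform continuity gives this because w^t and w^t g are close for large t,
     while their images are 1 and f g.
   - Median preservation gives it because p is close to the median of p and of
     the kernel elements p w^t p^-1 and p w^-t p^-1, so that f is bounded.
   Conversely, the images of the two factors commute, and commuting elements of
   a free group have a common power; hence, if neither factor is killed, f kills
   some (x^p, y^q) and is trivial.  A nontrivial f with thin kernel therefore
   factors through an injective homomorphism from one of the factors, and such a
   homomorphism is proper and has bounded cancellation. *)

Set Implicit Arguments.
Unset Strict Implicit.
Unset Printing Implicit Defensive.

Section FreeGroups.
Local Open Scope group_scope.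
Local Open Scope nat_scope.
Implicit Types n m k : nat.

(** * Word length and Gromov products in the Cayley tree *)

Definition wlen n (x : free_group n) : nat := size (fword x).

(* The Gromov product of x and y with respect to 1. *)
Definition gprod n (x y : free_group n) : nat :=
  size (lcp (fword x) (fword y)).

Arguments wlen {n} x%_g.
Arguments gprod {n} (x y)%_g.

Lemma wlen1 n : wlen (1 : free_group n) = 0.
Proof. by []. Qed.

Lemma wlenV n (x : free_group n) : wlen x^-1 = wlen x.
Proof. by rewrite /wlen /= /rinv size_rev size_map. Qed.

Lemma wlenM n (x y : free_group n) : wlen (x * y) <= wlen x + wlen y.
Proof. exact: size_rmul. Qed.

Lemma wlen_eq0 n (x : free_group n) : wlen x = 0 -> x = 1%g.
Proof. by move/size0nil => x0; apply: val_inj. Qed.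

Lemma wlen_fletter n (a : letter n) : wlen (fletter a) = 1.
Proof. by []. Qed.

Lemma gprodC n (x y : free_group n) : gprod x y = gprod y x.
Proof. by rewrite /gprod lcpC. Qed.

Lemma gprod_lel n (x y : free_group n) : gprod x y <= wlen x.
Proof.
rewrite /gprod /wlen; have [s [t [sE _ _]]] := lcpP (fword x) (fword y).
by rewrite [leqRHS](congr1 size sE) size_cat leq_addr.
Qed.

Lemma gprod_ler n (x y : free_group n) : gprod x y <= wlen y.
Proof. by rewrite gprodC gprod_lel. Qed.

(** This is 0-hyperbolicity of the tree; with [wlen_divl] it lets [lia] settle most of the tree
    geometry below. *)
Lemma gprod_ultra n (y x z : free_group n) :
  gprod x y <= gprod x z \/ gprod y z <= gprod x z.
Proof. by apply/orP; rewrite -geq_min lcp_ultra. Qed.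

Lemma gprod_prefix n (x y : free_group n) :
  (gprod x y == wlen x) = prefix (fword x) (fword y).
Proof.
have := prefix_lcp (fword x) (fword x) (fword y); rewrite prefix_refl /= => <-.
have [s [t [sE _ _]]] := lcpP (fword x) (fword y).
apply/eqP/idP => [xy|/prefixP[r rE]].
  have /eqP := congr1 size sE; rewrite size_cat [size (lcp _ _)]xy.
  rewrite -{1}[size _]addn0 eqn_add2l eq_sym => /nilP s0.
  by rewrite s0 cats0 in sE; rewrite -sE prefix_refl.
apply/eqP; rewrite eqn_leq gprod_lel /= /gprod /wlen rE size_cat.
exact: leq_addr.
Qed.

Lemma gprod1 n (x : free_group n) : gprod 1 x = 0.
Proof. by []. Qed.

Lemma wlen_triangle n (y x z : free_group n) :
  wlen (x^-1 * z) <= wlen (x^-1 * y) + wlen (y^-1 * z).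
Proof.
by have := wlenM (x^-1 * y)%g (y^-1 * z)%g; rewrite -mulgA (mulVKg y z).
Qed.

Lemma wlen_divC n (x y : free_group n) : wlen (x^-1 * y) = wlen (y^-1 * x).
Proof. by rewrite -wlenV invgM invgK. Qed.

Lemma on_geodesicP n (x y v : free_group n) :
  on_geodesic x y v <->
  wlen (x^-1 * v) + wlen (v^-1 * y) = wlen (x^-1 * y).
Proof. by rewrite /on_geodesic !cayley_distE; split => /eqP. Qed.

(** The vertex where the geodesics from 1 to [x] and to [y] part. As in [gprod_prefix],
    [gprod q x = wlen q] encodes that [q] is a prefix of [x]. *)
Lemma lcp_vertex n (x y : free_group n) : exists q,
  [/\ wlen q = gprod x y, gprod q x = wlen q & gprod q y = wlen q].
Proof.
have [s [t [sE tE _]]] := lcpP (fword x) (fword y).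
have rq : reduced (lcp (fword x) (fword y)).
  by have := fword_reduced x; rewrite {1}sE => /reduced_catl.
exists (FreeGroup rq); split=> //; apply/eqP; rewrite gprod_prefix /=.
  by rewrite [in X in prefix _ X]sE prefix_prefix.
by rewrite [in X in prefix _ X]tE prefix_prefix.
Qed.

(** The center of 1, [x], [y] is a common prefix, which bounds the distance from [x] to [y] below;
    the detour through the longest common prefix bounds it above. *)
Lemma wlen_divl n (x y : free_group n) :
  wlen (x^-1 * y) + 2 * gprod x y = wlen x + wlen y.
Proof.
have onP (z v : free_group n) :
    on_geodesic 1%g z v -> wlen v + wlen (v^-1 * z) = wlen z.
  by move/on_geodesicP; rewrite !invg1 !mul1g.
have [v /and3P[vx /on_geodesicP xvy vy]] := ex_center 1%g x y.
have dx := onP x v vx; have dy := onP y v vy.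
have le1 : wlen v <= gprod x y.
  by apply: size_prefix; rewrite prefix_lcp -!on_geodesic1 vx.
have [p [pl /eqP px /eqP py]] := lcp_vertex x y.
rewrite !gprod_prefix -!on_geodesic1 in px py.
have := onP x p px; have := onP y p py; have := wlen_triangle p x y.
have := wlen_divC v x; have := wlen_divC p x; lia.
Qed.

Lemma wlen_mul n (x y : free_group n) :
  wlen (x * y) + 2 * gprod x^-1 y = wlen x + wlen y.
Proof. by have := wlen_divl x^-1%g y; rewrite invgK wlenV. Qed.

(** * Cyclic reduction and growth of powers *)

Lemma gprod_gt0P n (x y : free_group n) : 0 < gprod x y ->
  exists a, gprod (fletter a) x = 1 /\ gprod (fletter a) y = 1.
Proof.
rewrite /gprod; case: (fword x) (fword y) => [|a s] [|b t] //=.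
by case: eqP => // <- _; exists a; rewrite eqxx.
Qed.

Lemma fletterV_neq n (a : letter n) : (fletter a)^-1%g <> fletter a.
Proof.
case: a => i b /(congr1 (@fword n)) /= [] /=; rewrite /linv /=.
by case: b.
Qed.

Lemma gprod_fletter1 n (a : letter n) (x : free_group n) :
  gprod (fletter a) x = 1 -> wlen x = 1 -> x = fletter a.
Proof.
move=> ax x1; have := wlen_divl (fletter a) x; rewrite ax x1 wlen_fletter => h.
have /wlen_eq0/mulg1_eq : wlen ((fletter a)^-1 * x) = 0 by lia.
by rewrite invgK.
Qed.

(** The word [x] starts with [a] and ends with its inverse, so conjugation cancels one letter at
    each end. *)
Lemma wlen_conj_fletter n (a : letter n) (x : free_group n) :
    gprod (fletter a) x = 1 -> gprod (fletter a) x^-1 = 1 ->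
  wlen (x ^ fletter a) + 2 = wlen x.
Proof.
set e := fletter a => ex exV; have e1 : wlen e = 1 by [].
(* A single letter would be equal to its own inverse. *)
have x2 : 1 < wlen x.
  have := gprod_ler e x; rewrite ex leq_eqVlt => /orP[/eqP x1|//].
  have xe := gprod_fletter1 ex (esym x1).
  have := gprod_fletter1 exV; rewrite wlenV -x1 => /(_ erefl).
  by rewrite xe => /fletterV_neq.
have h1 : wlen (x^-1 * e) + 2 = wlen x + 1.
  by have := wlen_mul x^-1%g e; rewrite invgK wlenV gprodC ex e1 muln1.
have h2 : 1 + 2 * gprod x^-1 (x^-1 * e) = wlen x + wlen (x^-1 * e).
  by have := wlen_divl x^-1%g (x^-1 * e)%g; rewrite invgK mulVKg wlenV e1.
have h3 : wlen (x ^ e) + 2 * gprod e (x^-1 * e) = wlen (x^-1 * e) + 1.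
  by have := wlen_divl (x^-1 * e)%g e; rewrite invgM invgK -mulgA gprodC e1.
have := gprod_ultra x^-1%g e (x^-1 * e)%g.
have := gprod_lel e (x^-1 * e)%g; lia.
Qed.

Lemma wlen_conj n (x t : free_group n) : wlen (x ^ t) <= wlen x + 2 * wlen t.
Proof.
apply: leq_trans (wlenM t^-1%g (x * t)%g) _; rewrite wlenV.
by have := wlenM x t; lia.
Qed.

Lemma wlen_expg_cyclically_reduced n (w : free_group n) :
  gprod w^-1 w = 0 -> forall M, wlen (w ^+ M) = M * wlen w.
Proof.
move=> ww M; have [->|w1] := eqVneq w 1%g; first by rewrite expg1n wlen1 muln0.
have wgt0 : 0 < wlen w.
  by case: (posnP (wlen w)) => // /wlen_eq0 w0; rewrite w0 eqxx in w1.
(* The second conjunct says that nothing cancels when [w ^+ M] is multiplied by [w] on the left. *)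
suff [//] : wlen (w ^+ M) = M * wlen w /\ gprod w^-1 (w ^+ M) = 0.
elim: M => [|M [IH1 IH2]]; first by rewrite expg0 gprodC.
have h1 : wlen (w ^+ M.+1) = wlen w + wlen (w ^+ M).
  by have := wlen_mul w (w ^+ M)%g; rewrite -expgS IH2 addn0.
have h2 : wlen (w ^+ M) + 2 * gprod w (w ^+ M.+1) = wlen w + wlen (w ^+ M.+1).
  by have := wlen_divl w (w ^+ M.+1)%g; rewrite {1}expgS mulKg.
have := gprod_ultra (w ^+ M.+1)%g w w^-1%g.
have := gprodC (w ^+ M.+1)%g w^-1%g; have := gprodC w w^-1%g.
lia.
Qed.

(** Here [l] is the length of a cyclically reduced conjugate of [w], and [c] grows by 2 for each
    conjugating letter. *)
Lemma wlen_expg n (w : free_group n) : w <> 1%g ->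
  exists l c, 0 < l /\
    forall M, M * l <= wlen (w ^+ M) + c /\ wlen (w ^+ M) <= M * l + c.
Proof.
have [N] := ubnP (wlen w); elim: N w => // N IH w wN w1.
have [ww|] := posnP (gprod w w^-1).
  rewrite gprodC in ww; exists (wlen w), 0; split.
    by case: (posnP (wlen w)) => // /wlen_eq0.
  by move=> M; rewrite wlen_expg_cyclically_reduced // addn0.
case/gprod_gt0P => a [aw awV]; have wa := wlen_conj_fletter aw awV.
have [||l [c [l0 H]]] := IH (w ^ fletter a)%g; first by lia.
  by move/eqP; rewrite conjg_eq1 => /eqP.
exists l, (c + 2); split=> // M.
pose u := ((w ^ fletter a) ^+ M)%g.
have [H1 H2] : M * l <= wlen u + c /\ wlen u <= M * l + c := H M.
have h1 : wlen u <= wlen (w ^+ M) + 2.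
  by rewrite /u -conjXg; exact: wlen_conj.
have h2 : wlen (w ^+ M) <= wlen u + 2.
  have := wlen_conj u (fletter a)^-1%g.
  by rewrite {1}/u -conjXg conjgK wlenV.
lia.
Qed.

Lemma expg_neq1 n (w : free_group n) M : w <> 1%g -> 0 < M -> (w ^+ M)%g <> 1%g.
Proof.
move=> w1 M0 wM; have [l [c [l0 H]]] := wlen_expg w1.
have [] := H (M * c.+1); rewrite expgnA wM expg1n wlen1; nia.
Qed.

(** * Commuting elements have a common power *)

Definition power_dependent n (a b : free_group n) : Prop :=
  exists p q, 0 < p + q /\ ((a ^+ p = b ^+ q)%g \/ (a ^+ p = b ^- q)%g).

Lemma power_dependentC n (a b : free_group n) :
  power_dependent a b -> power_dependent b a.
Proof.
case=> p [q [pq H]]; exists q, p; rewrite addnC; split=> //.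
by case: H => ->; [left|right; rewrite invgK].
Qed.

Lemma power_dependentV n (a b : free_group n) :
  power_dependent a^-1%g b -> power_dependent a b.
Proof.
case=> p [q [pq H]]; exists p, q; split=> //; rewrite expVgn in H.
by case: H => /(congr1 (fun x => x^-1)%g); rewrite !invgK; [right|left].
Qed.

Lemma power_dependentJ n (a b t : free_group n) :
  power_dependent (a ^ t)%g (b ^ t)%g -> power_dependent a b.
Proof.
case=> p [q [pq H]]; exists p, q; split=> //; move: H.
by rewrite -!conjXg -conjVg => -[/conjg_inj|/conjg_inj]; [left|right].
Qed.

(** One step of Euclid's algorithm: as [a] and [b] commute, the relation becomes $a^{p+q}=b^q$ or
    $a^{p-q}=b^{-q}$. Exponents are naturals, so the second case splits on the sign of $p-q$. *)
Lemma power_dependent_divl n (a b : free_group n) : commute a b ->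
  power_dependent a (a^-1 * b)%g -> power_dependent a b.
Proof.
move=> ab [p [q [pq H]]].
have E : ((a^-1 * b) ^+ q = a ^- q * b ^+ q)%g.
  rewrite expgMn ?expVgn //; apply/commute_sym/commuteV/commute_sym; exact: ab.
case: H; rewrite E => H.
  by exists (p + q), q; split; [lia|left; rewrite addnC expgnDr H mulVKg].
rewrite invgM invgK in H.
have {}H : (b ^+ q * a ^+ p = a ^+ q)%g by rewrite H mulVKg.
have [qp|/ltnW pq'] := leqP q p.
  exists (p - q), q; split; first by lia.
  right; rewrite expgnFr //; apply: (mulgI (b ^+ q)%g).
  by rewrite mulgA H !mulgV.
exists (q - p), q; split; first by lia.
by left; rewrite expgnFr // -H mulgK.
Qed.

(** Without cancellation, [a] and [b] are both prefixes of $ab=ba$, so the shorter is a prefix of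
    the longer. *)
Lemma gprod_commute n (a b : free_group n) : commute a b ->
  wlen a <= wlen b -> gprod a^-1 b = 0 -> gprod a b = wlen a.
Proof.
move=> ab le g0; have h := wlen_mul a b; rewrite g0 addn0 in h.
have h1 : wlen b + 2 * gprod a (a * b) = wlen a + wlen (a * b).
  by have := wlen_divl a (a * b)%g; rewrite mulKg.
have h2 : wlen a + 2 * gprod b (a * b) = wlen b + wlen (a * b).
  by have := wlen_divl b (a * b)%g; rewrite ab mulKg.
have := gprod_ultra (a * b)%g a b; have := gprod_lel a b.
have := gprodC b (a * b)%g; lia.
Qed.

(* Euclid's algorithm on the lengths: with |a| <= |b|, replace b by a^-1 b or
   a b when one of these is shorter than b; otherwise a, a^-1, b and b^-1 all
   start with the same letter, and conjugating by it shortens both. *)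
Lemma commute_power_dependent n (a b : free_group n) :
  commute a b -> power_dependent a b.
Proof.
have [N] := ubnP (wlen a + wlen b); elim: N a b => // N IH a b.
wlog le : a b / wlen a <= wlen b.
  move=> W abN ab; have [le|/ltnW le] := leqP (wlen a) (wlen b); first exact: W.
  apply: power_dependentC; apply: W => //; by rewrite addnC.
move=> abN ab.
have aVb : commute a^-1%g b by exact/commute_sym/commuteV/commute_sym.
have [/wlen_eq0 ->|a0] := posnP (wlen a).
  by exists 1, 0; split=> //; left; rewrite expg1 expg0.
have [lt|ge1] := ltnP (wlen (a^-1 * b)) (wlen b).
  apply: power_dependent_divl => //; apply: IH; first by lia.
  exact: commuteM (commuteV (commute_refl a)) ab.
have [lt|ge2] := ltnP (wlen (a * b)) (wlen b).
  apply: power_dependentV; apply: power_dependent_divl => //; rewrite invgK.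
  have : wlen a^-1 + wlen (a * b) < N by rewrite wlenV; lia.
  move/IH; apply.
  exact: commuteM (commute_sym (commuteV (commute_refl a))) aVb.
have h1 := wlen_divl a b; have h2 := wlen_mul a b.
(* Were there no common first letter, [gprod_commute] would make [a^-1] a prefix of [b], and [a * b]
   would be shorter than [b]. The same argument applies to [a^-1] and [b]. *)
have [g0|/gprod_gt0P [e [ea eb]]] := posnP (gprod a b).
  have := @gprod_commute _ a^-1%g b aVb; rewrite invgK wlenV => /(_ le g0).
  lia.
have [g0|gV] := posnP (gprod a^-1 b).
  by have := gprod_commute ab le g0; lia.
have eaV : gprod (fletter e) a^-1 = 1.
  have := gprod_ultra b (fletter e) a^-1%g; have := gprodC b a^-1%g.
  have := gprod_lel (fletter e) a^-1%g; rewrite wlen_fletter; lia.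
(* By commutation $ab^{-1}$ is the inverse of $a^{-1}b$, so both have the same length. *)
have gVV : gprod a^-1 b^-1 = gprod a b.
  have : wlen (a * b^-1) + 2 * gprod a^-1 b^-1 = wlen a + wlen b.
    by have := wlen_mul a b^-1%g; rewrite wlenV.
  have -> : wlen (a * b^-1) = wlen (a^-1 * b).
    by rewrite -wlenV invgM invgK aVb.
  lia.
have ebV : gprod (fletter e) b^-1 = 1.
  have := gprod_ultra a^-1%g (fletter e) b^-1%g.
  have : 0 < gprod a b.
    have := gprod_ultra (fletter e) a b; have := gprodC a (fletter e); lia.
  have := gprod_lel (fletter e) b^-1%g; rewrite wlen_fletter; lia.
have ca := wlen_conj_fletter ea eaV; have cb := wlen_conj_fletter eb ebV.
apply: (@power_dependentJ _ a b (fletter e)); apply: IH; first by lia.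
by rewrite /commute -!conjMg ab.
Qed.

(** * Finite balls, Lipschitz bounds and properness *)

Lemma wlen_case n (x : free_group n) :
  x = 1%g \/ exists a y, x = (fletter a * y)%g /\ wlen x = (wlen y).+1.
Proof.
case: x => -[|a s] rs; first by left; apply: val_inj.
right; exists a, (FreeGroup (reduced_behead rs)); split=> //.
by apply: val_inj; rewrite /= -[RHS]/(rmul [:: a] s) rmul_cat.
Qed.

Lemma wlen_case_rev n (x : free_group n) :
  x = 1%g \/ exists a y, x = (y * fletter a)%g /\ wlen x = (wlen y).+1.
Proof.
have [x1|[a [y [xE xl]]]] := wlen_case x^-1%g; [left|right].
  by apply: invg_inj; rewrite x1 invg1.
exists (linv a), y^-1%g; split; last by rewrite wlenV -xl wlenV.
by apply: invg_inj; rewrite xE -fletterV invgM !invgK.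
Qed.

Lemma finite_ball n R :
  exists s : seq (free_group n), forall x, wlen x <= R -> x \in s.
Proof.
elim: R => [|R [s sP]].
  by exists [:: 1%g] => x; rewrite leqn0 => /eqP/wlen_eq0 ->; rewrite mem_head.
exists (1%g :: [seq (fletter a * y)%g | a <- enum {: letter n}, y <- s]) => x.
have [-> _|[a [y [xE ->]]] yR] := wlen_case x; first exact: mem_head.
rewrite xE in_cons; apply/orP; right; apply/allpairsP; exists (a, y).
by split=> //=; [rewrite mem_enum|exact: sP].
Qed.

Lemma bounded_on_seq (T : eqType) (s : seq T) (f : T -> nat) :
  exists B, forall x, x \in s -> f x <= B.
Proof.
by exists (\max_(x <- s) f x) => x xs; exact: leq_bigmax_seq.
Qed.

Lemma morph_one (G H : groupType) (f : G -> H) :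
  {morph f : x y / (x * y)%g} -> f 1%g = 1%g.
Proof. by move=> fM; apply: (mulgI (f 1%g)); rewrite -fM !mulg1. Qed.

Lemma morph_inv (G H : groupType) (f : G -> H) :
  {morph f : x y / (x * y)%g} -> {morph f : x / (x^-1)%g}.
Proof.
by move=> fM x; apply: (mulgI (f x)); rewrite -fM !mulgV (morph_one fM).
Qed.

Lemma morph_exp (G H : groupType) (f : G -> H) k :
  {morph f : x y / (x * y)%g} -> {morph f : x / (x ^+ k)%g}.
Proof.
move=> fM x; elim: k => [|k IH]; first by rewrite !expg0 (morph_one fM).
by rewrite !expgS fM IH.
Qed.

Lemma morph_lipschitz n k (f : free_group n -> free_group k) :
  {morph f : x y / (x * y)%g} -> exists L, forall x, wlen (f x) <= L * wlen x.
Proof.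
move=> fM.
have [L LP] := bounded_on_seq (enum {: letter n}) (fun a => wlen (f (fletter a))).
exists L => x; have [N] := ubnP (wlen x); elim: N x => // N IH x.
have [->|[a [y [xE xl]]] xN] := wlen_case x; first by rewrite (morph_one fM).
have IHy : wlen (f y) <= L * wlen y by apply: IH; lia.
have La : wlen (f (fletter a)) <= L by apply: LP; rewrite mem_enum.
by rewrite xl mulnS xE fM; apply: leq_trans (wlenM _ _) (leq_add La IHy).
Qed.

(** The ball of radius [R] is finite, and each of its elements has at most one preimage. *)
Lemma injective_morph_proper n k (f : free_group n -> free_group k) :
  injective f -> forall R, exists D, forall x, wlen (f x) <= R -> wlen x <= D.
Proof.
move=> fI R; have [s sP] := finite_ball k R.
suff [D DP] : exists D, forall x, f x \in s -> wlen x <= D.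
  by exists D => x /sP; exact: DP.
elim: s {sP} => [|h s [D DP]]; first by exists 0.
have [[x fx]|nx] := pselect (exists x, f x = h).
  exists (maxn (wlen x) D) => y; rewrite in_cons leq_max => /orP[/eqP yh|/DP ->].
    by rewrite -fx in yh; rewrite (fI _ _ yh) leqnn.
  by rewrite orbT.
exists D => y; rewrite in_cons => /orP[/eqP yh|/DP //].
by case: nx; exists y.
Qed.

(** * Bounded cancellation for injective homomorphisms *)

(** Removing [q] separates [g] from [g * h] in the tree, so the geodesic between them, of length
    [wlen h], passes through [q]. *)
Lemma geodesic_crossing n (q g h : free_group n) :
    gprod q (g * h) = wlen q -> gprod q g < wlen q ->
  wlen (q^-1 * g) <= wlen h.
Proof.
move=> qgh qg.
have h1 : wlen h + 2 * gprod g (g * h) = wlen g + wlen (g * h).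
  by have := wlen_divl g (g * h)%g; rewrite mulKg.
have h2 := wlen_divl q g; have h3 := gprod_lel q (g * h)%g.
have h4 := gprod_ler q (g * h)%g.
have := gprod_ultra (g * h)%g q g; have := gprodC g (g * h)%g; lia.
Qed.

(** The images of the prefixes of [x] form a path from 1 to [f x] with jumps of length at most [L];
    some jump has to cross [q]. *)
Lemma morph_path_near_prefix n k (f : free_group n -> free_group k) L :
    {morph f : x y / (x * y)%g} -> (forall x, wlen (f x) <= L * wlen x) ->
  forall x q, gprod q (f x) = wlen q ->
  exists u v, [/\ x = (u * v)%g, wlen x = wlen u + wlen v &
                  wlen (q^-1 * f u) <= L].
Proof.
move=> fM fL x; have [N] := ubnP (wlen x); elim: N x => // N IH x.
have [->|[a [y [xE xl]]] xN q qx] := wlen_case_rev x.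
  rewrite (morph_one fM) => _ q; rewrite gprodC gprod1 => /esym/wlen_eq0 ->.
  by exists 1%g, 1%g; split; rewrite ?mulg1 // (morph_one fM) mulg1 wlenV.
have [qy|qy] := eqVneq (gprod q (f y)) (wlen q); last first.
  exists y, (fletter a); split=> //; first by rewrite xl wlen_fletter addn1.
  apply: leq_trans (@geodesic_crossing _ q (f y) (f (fletter a)) _ _) _.
  - by rewrite -fM -xE.
  - by rewrite ltn_neqAle qy gprod_lel.
  - by have := fL (fletter a); rewrite wlen_fletter muln1.
have [|u [v [yE yl uq]]] := IH y _ q qy; first by lia.
exists u, (v * fletter a)%g; split=> //; first by rewrite xE yE mulgA.
have := wlenM u (v * fletter a)%g; rewrite mulgA -yE -xE.
have := wlenM v (fletter a); rewrite wlen_fletter; lia.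
Qed.

(* If q is the last common vertex of the paths to f x and f y, both paths f u,
   f v (with u, v prefixes of x, y) pass near q, so u^-1 v, which is reduced,
   has short image; by properness u is short, hence so is q. *)
Lemma bounded_cancellation n k (f : free_group n -> free_group k) :
    {morph f : x y / (x * y)%g} -> injective f ->
  exists C, forall x y, gprod x y = 0 -> gprod (f x) (f y) <= C.
Proof.
move=> fM fI; have [L fL] := morph_lipschitz fM.
have [D DP] := injective_morph_proper fI (L + L).
exists (L * D + L) => x y xy; have [q [<- qx qy]] := lcp_vertex (f x) (f y).
have [u [u' [xE xl uq]]] := morph_path_near_prefix fM fL qx.
have [v [v' [yE yl vq]]] := morph_path_near_prefix fM fL qy.
have uvD : wlen (u^-1 * v) <= D.
  apply: DP; rewrite fM (morph_inv fM).
  apply: leq_trans (wlen_triangle q _ _) _.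
  by rewrite wlen_divC leq_add.
(* Since [gprod x y = 0], the left side is $|u|+|u'|+|v|+|v'|$, whence $|u|+|v|\le D$. *)
have le1 : wlen (x^-1 * y) <= wlen u' + wlen (u^-1 * v) + wlen v'.
  have -> : (x^-1 * y = u'^-1 * ((u^-1 * v) * v'))%g.
    by rewrite xE yE invgM !mulgA.
  apply: leq_trans (wlenM _ _) _; rewrite wlenV -addnA leq_add2l.
  exact: wlenM.
have xyl := wlen_divl x y; have fu := fL u.
have le2 : wlen q <= wlen (f u) + L.
  have := wlenM (f u) ((f u)^-1 * q)%g.
  by rewrite mulVKg wlen_divC; lia.
nia.
Qed.

(** * Medians and Gromov products *)

Lemma median_geodesic n (x y z : free_group n) (v := median x y z) :
  [/\ wlen (x^-1 * v) + wlen (v^-1 * y) = wlen (x^-1 * y),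
      wlen (y^-1 * v) + wlen (v^-1 * z) = wlen (y^-1 * z) &
      wlen (x^-1 * v) + wlen (v^-1 * z) = wlen (x^-1 * z)].
Proof.
have /and3P[/on_geodesicP ? /on_geodesicP ? /on_geodesicP ?] : is_center x y z v.
  by rewrite medianP.
by [].
Qed.

Lemma medianM n (t x y z : free_group n) :
  median (t * x)%g (t * y)%g (t * z)%g = (t * median x y z)%g.
Proof. by apply/esym/eqP; rewrite -medianP is_centerM medianP. Qed.

Lemma medianxx n (x z : free_group n) : median x x z = x.
Proof.
have [h _ _] := median_geodesic x x z; apply/esym/(mulgI x^-1%g).
rewrite mulVg; apply/esym/wlen_eq0; move: h; rewrite mulVg wlen1.
by move/eqP; rewrite addn_eq0 => /andP[/eqP].
Qed.

(** Seen from 1, the median lies on the geodesics to at least two of the three points, so it is a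
    common prefix of these. *)
Lemma wlen_median n (x y z : free_group n) C :
  gprod x y <= C -> gprod y z <= C -> gprod x z <= C ->
  wlen (median x y z) <= C.
Proof.
move=> xyC yzC xzC; have [] := median_geodesic x y z.
set v := median x y z.
have := wlen_divl x v; have := wlen_divl v y; have := wlen_divl y v.
have := wlen_divl v z; have := wlen_divl x y; have := wlen_divl y z.
have := wlen_divl x z; have := gprod_ultra v x y; have := gprod_ultra v y z.
have := gprod_ultra v x z; have := gprod_lel v y; have := gprod_lel v z.
have := gprod_ler x v; have := gprodC v y; lia.
Qed.

Lemma gprod_geodesic n (x y v : free_group n) :
  wlen (x^-1 * v) + wlen (v^-1 * y) = wlen (x^-1 * y) ->
  gprod (v^-1 * x) (v^-1 * y) = 0.
Proof.
have := wlen_divl (v^-1 * x)%g (v^-1 * y)%g.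
rewrite invgM invgK -mulgA mulVKg (wlen_divC v x) => h1 h2.
by move/eqP: h1; rewrite -h2 -[X in _ == X]addn0 eqn_add2l muln_eq0 => /eqP.
Qed.

(** The vertex where the geodesics from 1 to [x] and to [y] part cuts the former into two pieces,
    measured from [x] and from 1. *)
Lemma gprod_shift n (x y : free_group n) :
  gprod x^-1 (x^-1 * y) + gprod x y = wlen x.
Proof.
have h1 : wlen y + 2 * gprod x^-1 (x^-1 * y) = wlen x + wlen (x^-1 * y).
  by have := wlen_mul x (x^-1 * y)%g; rewrite mulVKg.
by have := wlen_divl x y; lia.
Qed.

(** * Homomorphisms to a free group with thin kernel *)

(** This says that the prefix distance is below $2^{-N}$; equality is a separate case because
    [gprod u u] is only [wlen u]. *)
Definition near_upto n N (u v : free_group n) : Prop :=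
  u = v \/ N < gprod u v.

Definition coord_unif_continuous n m k
    (f : free_group n * free_group m -> free_group k) : Prop :=
  forall N, exists M, forall x y,
    near_upto M x.1 y.1 -> near_upto M x.2 y.2 -> near_upto N (f x) (f y).

Definition coord_median_preserving n m k
    (f : free_group n * free_group m -> free_group k) : Prop :=
  exists C, forall x y z,
    wlen ((f (prod_median x y z))^-1 * median (f x) (f y) (f z)) <= C.

Definition thin_kernel n m k
    (f : free_group n * free_group m -> free_group k) : Prop :=
  forall w, f w = 1%g -> w.1 <> 1%g -> w.2 <> 1%g -> forall g, f g = 1%g.

(** Once the median is translated to 1, the three points pairwise share no first letter. Bounded
    cancellation then keeps the Gromov products of their images, hence the median of these,
    small. *)
Lemma injective_median_preserving n k (f : free_group n -> free_group k) :
    {morph f : x y / (x * y)%g} -> injective f ->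
  exists C, forall x y z,
    wlen ((f (median x y z))^-1 * median (f x) (f y) (f z)) <= C.
Proof.
move=> fM fI; have [C CP] := bounded_cancellation fM fI.
exists C => x y z; have [xy yz xz] := median_geodesic x y z.
rewrite -medianM -!(morph_inv fM) -!fM.
by apply: wlen_median; apply: CP; apply: gprod_geodesic.
Qed.

(** A long common prefix [p] has an image longer than [N + C] by properness, and bounded
    cancellation removes at most [C] letters of it in [f x] and in [f y]. *)
Lemma injective_unif_continuous n k (f : free_group n -> free_group k) :
    {morph f : x y / (x * y)%g} -> injective f ->
  forall N, exists M, forall x y, near_upto M x y -> near_upto N (f x) (f y).
Proof.
move=> fM fI N; have [C CP] := bounded_cancellation fM fI.
have [M MP] := injective_morph_proper fI (N + C).
exists M => x y [->|xy]; first by left.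
have [p [pl px py]] := lcp_vertex x y.
have fpl : N + C < wlen (f p).
  by rewrite ltnNge; apply/negP => /MP; lia.
have near z : gprod p z = wlen p -> N < gprod (f p) (f z).
  move=> pz; have pz0 : gprod p^-1 (p^-1 * z) = 0.
    by have := gprod_shift p z; lia.
  have : gprod (f p)^-1 ((f p)^-1 * f z) <= C.
    by rewrite -(morph_inv fM) -fM; exact: CP.
  have := gprod_shift (f p) (f z); lia.
right; have := gprod_ultra (f p) (f x) (f y); have := near x px.
have := near y py; have := gprodC (f p) (f x); lia.
Qed.

Lemma coord_morphl n m k (f : free_group n * free_group m -> free_group k) :
  {morph f : x y / (x * y)%g} -> {morph f \o pair^~ 1%g : x y / (x * y)%g}.
Proof.
by move=> fM x y /=; rewrite -fM; congr (f (_, _)); rewrite mulg1.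
Qed.

Lemma coord_morphr n m k (f : free_group n * free_group m -> free_group k) :
  {morph f : x y / (x * y)%g} -> {morph f \o pair 1%g : x y / (x * y)%g}.
Proof.
by move=> fM x y /=; rewrite -fM; congr (f (_, _)); rewrite mulg1.
Qed.

Lemma coord_split n m k (f : free_group n * free_group m -> free_group k) :
    {morph f : x y / (x * y)%g} ->
  forall g, f g = (f (g.1, 1) * f (1, g.2))%g.
Proof.
by move=> fM [x y]; rewrite -fM; congr (f (_, _)); rewrite /= ?mulg1 ?mul1g.
Qed.

Lemma fletter_neq1 n (a : letter n) : fletter a <> 1%g.
Proof. by move/(congr1 (@fword n)). Qed.

Lemma morph_injective (G H : groupType) (f : G -> H) :
    {morph f : x y / (x * y)%g} -> (forall x, f x = 1%g -> x = 1%g) ->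
  injective f.
Proof.
move=> fM f1 x y fxy; apply: divg1_eq; apply: f1.
by rewrite fM (morph_inv fM) fxy mulgV.
Qed.

Lemma thin_kernelP n m k (f : free_group n * free_group m -> free_group k) :
    0 < n -> 0 < m -> {morph f : x y / (x * y)%g} -> thin_kernel f ->
  [\/ forall g, f g = 1%g,
      exists2 h : free_group n -> free_group k,
        {morph h : x y / (x * y)%g} /\ injective h & f =1 h \o fst |
      exists2 h : free_group m -> free_group k,
        {morph h : x y / (x * y)%g} /\ injective h & f =1 h \o snd].
Proof.
move=> n0 m0 fM fT.
have [triv|nf] := pselect (forall g, f g = 1%g); first by constructor 1.
have fs := coord_split fM.
(* Nontrivial kernel elements in both factors would multiply to one that thinness forbids. *)
have f2 y : y <> 1%g -> f (1%g, y) = 1%g -> forall x, f (x, 1%g) = 1%g -> x = 1%g.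
  move=> y1 fy x fx; apply: contra_notP nf => x1.
  by apply: (fT (x, y)) => //; rewrite fs /= fx fy mulg1.
pose a := fletter (Ordinal n0, true); pose b := fletter (Ordinal m0, true).
have [f0|/existsNP [y fy]] := pselect (forall y, f (1%g, y) = 1%g).
  constructor 2; exists (f \o pair^~ 1%g); last by move=> g; rewrite fs f0 mulg1.
  split; first exact: coord_morphl.
  apply: morph_injective; first exact: coord_morphl.
  exact: f2 (@fletter_neq1 _ _) (f0 b).
have [f0|/existsNP [x fx]] := pselect (forall x, f (x, 1%g) = 1%g).
  constructor 3; exists (f \o pair 1%g); last by move=> g; rewrite fs f0 mul1g.
  split; first exact: coord_morphr.
  apply: morph_injective; first exact: coord_morphr.
  move=> z fz; have [//|z1] := pselect (z = 1%g).
  by have /(@fletter_neq1 _) := f2 z z1 fz a (f0 a).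
(* Neither factor is killed. A common power of the two commuting images yields a kernel element with
   both entries nontrivial. *)
case: nf; have ab : commute (f (x, 1%g)) (f (1%g, y)).
  by rewrite /commute -!fM; congr (f (_, _)); rewrite /= !(mulg1, mul1g).
have x1 : x <> 1%g by move=> x1; apply: fx; rewrite x1 -(morph_one fM).
have y1 : y <> 1%g by move=> y1; apply: fy; rewrite y1 -(morph_one fM).
have fXl p : (f (x, 1) ^+ p = f (x ^+ p, 1))%g.
  exact/esym/(morph_exp p (coord_morphl fM)).
have fXr p : (f (1, y) ^+ p = f (1, y ^+ p))%g.
  exact/esym/(morph_exp p (coord_morphr fM)).
have fVr z : f (1, z^-1)%g = (f (1, z))^-1%g.
  exact: (morph_inv (coord_morphr fM)).
have [p [q [pq H]]] := commute_power_dependent ab.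
(* A zero exponent would give a nontrivial element of finite order. *)
have p0 : 0 < p.
  rewrite lt0n; apply/eqP => p0; rewrite p0 expg0 in H pq.
  apply: (expg_neq1 fy (M := q)) => //.
  by case: H => [<-//|/esym/eqP]; rewrite invg_eq1 => /eqP.
have q0 : 0 < q.
  rewrite lt0n; apply/eqP => q0; rewrite q0 expg0 invg1 addn0 in H pq.
  by apply: (expg_neq1 fx (M := p)) => //; case: H.
have xp := expg_neq1 x1 p0; have yq := expg_neq1 y1 q0.
case: H => H.
  apply: (fT (x ^+ p, y ^- q)%g) => //=.
    by rewrite fs /= -fXl H fXr fVr mulgV.
  by move/eqP; rewrite invg_eq1 => /eqP.
apply: (fT (x ^+ p, y ^+ q)%g) => //=.
by rewrite fs /= -fXl H fXr mulVg.
Qed.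

Lemma thin_kernel_unif_continuous n m k
    (f : free_group n * free_group m -> free_group k) :
    0 < n -> 0 < m -> {morph f : x y / (x * y)%g} -> thin_kernel f ->
  coord_unif_continuous f.
Proof.
move=> n0 m0 fM fT N.
have [f1|[h [hM hI] fE]|[h [hM hI] fE]] := thin_kernelP n0 m0 fM fT.
- by exists 0 => x y _ _; left; rewrite !f1.
- have [M MP] := injective_unif_continuous hM hI N.
  by exists M => x y xy _; rewrite !fE; exact: MP.
- have [M MP] := injective_unif_continuous hM hI N.
  by exists M => x y _ xy; rewrite !fE; exact: MP.
Qed.

Lemma thin_kernel_median_preserving n m k
    (f : free_group n * free_group m -> free_group k) :
    0 < n -> 0 < m -> {morph f : x y / (x * y)%g} -> thin_kernel f ->
  coord_median_preserving f.
Proof.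
move=> n0 m0 fM fT.
have [f1|[h [hM hI] fE]|[h [hM hI] fE]] := thin_kernelP n0 m0 fM fT.
- by exists 0 => x y z; rewrite !f1 medianxx mulVg.
- have [C CP] := injective_median_preserving hM hI.
  by exists C => x y z; rewrite !fE; exact: CP.
- have [C CP] := injective_median_preserving hM hI.
  by exists C => x y z; rewrite !fE; exact: CP.
Qed.

(** * Each of the two conditions forces a thin kernel *)

(** Multiplying by [y] on the right cancels at most [wlen y] final letters of [x]. *)
Lemma gprod_mulr n (x y : free_group n) : wlen x <= gprod x (x * y) + wlen y.
Proof.
have h1 : wlen y + 2 * gprod x (x * y) = wlen x + wlen (x * y).
  by have := wlen_divl x (x * y)%g; rewrite mulKg.
have := gprod_ler x (x * y)%g; have := wlenM (x * y)%g y^-1%g.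
rewrite mulgK wlenV; lia.
Qed.

Lemma unif_continuous_thin_kernel n m k
    (f : free_group n * free_group m -> free_group k) :
  {morph f : x y / (x * y)%g} -> coord_unif_continuous f -> thin_kernel f.
Proof.
move=> fM fU w fw w1 w2 g; have [M MP] := fU 0.
have [l1 [c1 [l1gt0 H1]]] := wlen_expg w1.
have [l2 [c2 [l2gt0 H2]]] := wlen_expg w2.
have [t [t1 t2]] : exists t, M + wlen g.1 + c1 < t /\ M + wlen g.2 + c2 < t.
  by exists (M + wlen g.1 + c1 + (M + wlen g.2 + c2)).+1; lia.
pose u : free_group n * free_group m := (w ^+ t)%g.
have u1 : u.1 = (w.1 ^+ t)%g by exact: morph_exp.
have u2 : u.2 = (w.2 ^+ t)%g by exact: morph_exp.
have N1 : M < gprod u.1 (u.1 * g.1).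
  have L : t * l1 <= wlen u.1 + c1 by rewrite u1; case: (H1 t).
  have := leq_pmulr t l1gt0; have := gprod_mulr u.1 g.1; lia.
have N2 : M < gprod u.2 (u.2 * g.2).
  have L : t * l2 <= wlen u.2 + c2 by rewrite u2; case: (H2 t).
  have := leq_pmulr t l2gt0; have := gprod_mulr u.2 g.2; lia.
have fu : f u = 1%g by rewrite (morph_exp _ fM) fw expg1n.
(* As [f u = 1] and [gprod 1 _] is 0, [near_upto 0] leaves only equality. *)
by have [] := MP u (u * g)%g (or_intror N1) (or_intror N2); rewrite fM fu mul1g.
Qed.

Lemma gprod_mulr_stable n (x y p : free_group n) c :
    gprod x y <= c -> wlen p + c < wlen x -> wlen p + c < wlen y ->
  gprod (x * p) (y * p) <= c.
Proof.
move=> xy xp yp; have h1 := gprod_mulr x p; have h2 := gprod_mulr y p.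
have := gprod_ultra (x * p)%g x (y * p)%g; have := gprod_ultra (y * p)%g x y.
have := gprodC y (y * p)%g; lia.
Qed.

(** Seen from [p], large positive and negative powers of [w] point in different directions. Only the
    threshold [M0] depends on [p], not the bound [c]. *)
Lemma median_expg_conj n (w : free_group n) : w <> 1%g ->
  exists c, forall p : free_group n, exists M0, forall M, M0 <= M ->
    wlen (p^-1 * median (p * w ^+ M * p^-1)%g (p * w ^- M * p^-1)%g p) <= c.
Proof.
move=> w1; have [l [c [l0 H]]] := wlen_expg w1.
(* This makes [w ^+ M] longer than [wlen p + 2 * c], the margin needed in [gprod_mulr_stable]. *)
exists (2 * c) => p; exists (wlen p + 3 * c + 1) => M leM.
rewrite -medianM !mulgA mulVg !mul1g.
pose u : free_group n := (w ^+ M)%g; rewrite -/u.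
have [Lu Uu] : M * l <= wlen u + c /\ wlen u <= M * l + c := H M.
have uu : gprod u u^-1 <= 2 * c.
  have := wlen_divl u u^-1%g; have : wlen (u^-1 * u^-1) = wlen (w ^+ (M + M)).
    by rewrite -invgM wlenV expgnDr.
  by have [] := H (M + M); rewrite wlenV; nia.
have := leq_pmulr M l0 => Ml.
apply: wlen_median; [|by rewrite gprodC gprod1|by rewrite gprodC gprod1].
by apply: gprod_mulr_stable; rewrite ?wlenV //; lia.
Qed.

Lemma median_preserving_thin_kernel n m k
    (f : free_group n * free_group m -> free_group k) :
  {morph f : x y / (x * y)%g} -> coord_median_preserving f -> thin_kernel f.
Proof.
move=> fM [C CP] w fw w1 w2.
(* A nontrivial value of [f] would have powers of unbounded length in the image. *)
suff [B BP] : exists B, forall g, wlen (f g) <= B.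
  move=> g; have [//|fg] := pselect (f g = 1%g).
  have [l [c [l0 H]]] := wlen_expg fg; pose t := B + c + 1.
  have [Ht _] := H t; have Bt : wlen (f g ^+ t) <= B.
    by rewrite -(morph_exp t fM).
  by have := leq_pmulr t l0; lia.
have [c1 H1] := median_expg_conj w1; have [c2 H2] := median_expg_conj w2.
have [L1 LP1] := morph_lipschitz (coord_morphl fM).
have [L2 LP2] := morph_lipschitz (coord_morphr fM).
(* Here [C] bounds the image of the median of [x], [y] and [p], where [f x = f y = 1]; the rest
   bounds the image of the displacement [v] from [p] to that median. *)
exists (C + (L1 * c1 + L2 * c2)) => p.
have [M1 MP1] := H1 p.1; have [M2 MP2] := H2 p.2.
pose M := M1 + M2; pose x := (p * w ^+ M * p^-1)%g.
pose y := (p * w ^- M * p^-1)%g; pose v := (p^-1 * prod_median x y p)%g.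
have e1 : (w ^+ M)%g.1 = (w.1 ^+ M)%g by exact: morph_exp.
have e2 : (w ^+ M)%g.2 = (w.2 ^+ M)%g by exact: morph_exp.
have v1 : wlen v.1 <= c1 by rewrite /= e1; apply: MP1; exact: leq_addr.
have v2 : wlen v.2 <= c2 by rewrite /= e2; apply: MP2; exact: leq_addl.
have fx : f x = 1%g.
  by rewrite /x !fM (morph_inv fM) (morph_exp _ fM) fw expg1n mulg1 mulgV.
have fy : f y = 1%g.
  by rewrite /y !fM !(morph_inv fM) (morph_exp _ fM) fw expg1n invg1 mulg1 mulgV.
have fv : wlen (f v) <= L1 * c1 + L2 * c2.
  rewrite (coord_split fM); apply: leq_trans (wlenM _ _) _.
  apply: leq_add; [apply: leq_trans (LP1 _) _|apply: leq_trans (LP2 _) _];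
    by rewrite leq_mul2l ?v1 ?v2 orbT.
have := CP x y p; rewrite fx fy medianxx mulg1 wlenV => fC.
have -> : f p = (f (prod_median x y p) * (f v)^-1)%g.
  by rewrite -(morph_inv fM) -fM /v invgM invgK mulVKg.
by apply: leq_trans (wlenM _ _) _; rewrite wlenV leq_add.
Qed.

(** * Passage from an arbitrary word metric to coordinates *)

Section WordMetric.
Variables (n m : nat) (S : seq (free_group n * free_group m)).
Hypothesis genS : generates S.

Lemma word_dist_ge_coord : exists L, forall g h : free_group n * free_group m,
  wlen (g.1^-1 * h.1) <= L * word_dist genS g h /\
  wlen (g.2^-1 * h.2) <= L * word_dist genS g h.
Proof.
have [L LP] := bounded_on_seq S (fun s => wlen s.1 + wlen s.2).
exists L => g h; rewrite /word_dist /word_length.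
case: ex_minnP => k /asboolP[w [<- wS E]] _.
rewrite -[(g.1^-1 * h.1)%g]/(g^-1 * h)%g.1 -[(g.2^-1 * h.2)%g]/(g^-1 * h)%g.2.
rewrite E; elim: w wS {E} => [|s w IH] wS; first by rewrite big_nil.
have [IH1 IH2] : wlen (\prod_(s <- w) s)%g.1 <= L * size w /\
                 wlen (\prod_(s <- w) s)%g.2 <= L * size w.
  by apply: IH => t tw; apply: wS; rewrite in_cons tw orbT.
have sL : wlen s.1 + wlen s.2 <= L.
  have [/LP //|/LP] := wS s (mem_head _ _); by rewrite !wlenV.
rewrite big_cons mulnS; split; apply: leq_trans (wlenM _ _) _; apply: leq_add => //.
  exact: leq_trans (leq_addr _ _) sL.
exact: leq_trans (leq_addl _ _) sL.
Qed.

(** Only finitely many values of [g^-1 * h] occur, so their word lengths over [S] have a maximum. *)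
Lemma word_dist_le_coord C : exists B, forall g h : free_group n * free_group m,
  wlen (g.1^-1 * h.1) <= C -> wlen (g.2^-1 * h.2) <= C ->
  word_dist genS g h <= B.
Proof.
have [s sP] := finite_ball n C; have [t tP] := finite_ball m C.
have [B BP] := bounded_on_seq [seq (x, y) | x <- s, y <- t] (word_length genS).
exists B => g h gh1 gh2; apply: BP.
by apply/allpairsP; exists ((g.1^-1 * h.1)%g, (g.2^-1 * h.2)%g); split; auto.
Qed.

Lemma coarse_median_preserving_coord
    (Phi : free_group n * free_group m -> free_group n * free_group m) :
  coarse_median_preserving genS Phi <->
  coord_median_preserving (fst \o Phi) /\ coord_median_preserving (snd \o Phi).
Proof.
split=> [[C CP]|[[C1 CP1] [C2 CP2]]].
  have [L LP] := word_dist_ge_coord.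
  by split; exists (L * C) => x y z;
    have [L1 L2] := LP (Phi (prod_median x y z))
      (prod_median (Phi x) (Phi y) (Phi z));
    [apply: leq_trans L1 _|apply: leq_trans L2 _]; rewrite leq_mul2l CP orbT.
have [B BP] := word_dist_le_coord (C1 + C2).
exists B => x y z; apply: BP; [exact: leq_trans (CP1 x y z) (leq_addr _ _)|].
exact: leq_trans (CP2 x y z) (leq_addl _ _).
Qed.

End WordMetric.

(** * Passage from the prefix metric to coordinates *)

Section PrefixMetric.
Local Open Scope ring_scope.
Import Order.TTheory GRing.Theory Num.Theory.
Variable R : realType.

Lemma prefix_dist_lt n N (u v : prefix_space R n) :
  prefix_dist u v < 2^-1 ^+ N <-> near_upto N (u : free_group n) v.
Proof.
have i0 : 0 < (2^-1 : R) by rewrite invr_gt0 ltr0n.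
have i1 : (2^-1 : R) < 1 by rewrite invf_lt1 ?ltr0n ?ltr1n.
rewrite /prefix_dist /near_upto; case: eqVneq => [->|uv].
  by split=> _; [left|rewrite exprn_gt0].
rewrite ltr_iXn2l //; split=> [|[uv'|//]]; first by right.
by rewrite uv' eqxx in uv.
Qed.

Lemma exp_half_lt (e : R) : 0 < e -> exists N, 2^-1 ^+ N < e.
Proof.
move=> e0; exists (Num.bound e^-1); rewrite exprVn invf_plt ?posrE ?exprn_gt0 //.
exact: upper_nthrootP.
Qed.

Lemma prefix_unif_continuous_coord n m
    (Phi : free_group n * free_group m -> free_group n * free_group m) :
  prefix_unif_continuous R Phi <->
  coord_unif_continuous (fst \o Phi) /\ coord_unif_continuous (snd \o Phi).
Proof.
have half0 N : 0 < (2^-1 : R) ^+ N by rewrite exprn_gt0 // invr_gt0 ltr0n.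
split=> [/prefix_unif_continuousP U|[U1 U2]].
  have {}U N : exists M, forall x y : free_group n * free_group m,
      near_upto M x.1 y.1 -> near_upto M x.2 y.2 ->
      near_upto N (Phi x).1 (Phi y).1 /\ near_upto N (Phi x).2 (Phi y).2.
    have [d d0 dP] := U _ (half0 N); have [M Md] := exp_half_lt d0.
    exists M => x y xy1 xy2; have := dP x y; rewrite !gt_max.
    case/(_ _)/andP; last by move=> /prefix_dist_lt ? /prefix_dist_lt ?.
    by apply/andP; split; apply: lt_trans Md; apply/prefix_dist_lt.
  by split=> N; have [M MP] := U N; exists M => x y xy1 xy2;
    have [] := MP x y xy1 xy2.
apply/prefix_unif_continuousP => e e0; have [N Ne] := exp_half_lt e0.
have [M1 MP1] := U1 N; have [M2 MP2] := U2 N.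
have mono k M M' (u v : free_group k) : (M <= M')%N ->
    near_upto M' u v -> near_upto M u v.
  by move=> MM [->|uv]; [left|right; exact: leq_ltn_trans uv].
(* The exponent dominates both [M1] and [M2], so [mono] serves either coordinate. *)
exists (2^-1 ^+ (M1 + M2)) => // x y; rewrite !gt_max.
case/andP=> /prefix_dist_lt xy1 /prefix_dist_lt xy2.
apply/andP; split; apply: lt_trans Ne; apply/prefix_dist_lt.
  by apply: MP1; [apply: mono xy1|apply: mono xy2]; exact: leq_addr.
by apply: MP2; [apply: mono xy1|apply: mono xy2]; exact: leq_addl.
Qed.

End PrefixMetric.

Lemma coord_median_preserving_unif_continuous n m k
    (f : free_group n * free_group m -> free_group k) :
    0 < n -> 0 < m -> {morph f : x y / (x * y)%g} ->
  coord_median_preserving f <-> coord_unif_continuous f.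
Proof.
move=> n0 m0 fM; split.
  move/(median_preserving_thin_kernel fM).
  exact: thin_kernel_unif_continuous n0 m0 fM.
move/(unif_continuous_thin_kernel fM).
exact: thin_kernel_median_preserving n0 m0 fM.
Qed.

End FreeGroups.

Theorem theorem5p2 (R : realType) (n m : nat) (hn : 2 <= n) (hm : 2 <= m)
    (S : seq (free_group n * free_group m)) (genS : generates S)
    (Phi : {multiplicative free_group n * free_group m ->
                           free_group n * free_group m}) :
  coarse_median_preserving genS Phi <-> prefix_unif_continuous R Phi.
Proof.
rewrite coarse_median_preserving_coord prefix_unif_continuous_coord.
rewrite !coord_median_preserving_unif_continuous //; try exact: ltnW;
  by move=> x y; rewrite /= gmulfM.
Qed.
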